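(* Let $L, M$ be two full-rank lattices in $\mathbb{R}^d$ with $\mathrm{vol}(L) < \mathrm{vol}(M)$ and $L \cap M = \{0\}$. Let $F \subseteq \mathbb{R}^d$ be a (not necessarily measurable) set that is a common fundamental domain of $L$ and $M$ in $\mathbb{R}^d$. Then $F$ is unbounded.
   Context: A lattice in $\mathbb{R}^d$ is a discrete subgroup of $\mathbb{R}^d$; it is full-rank if it spans $\mathbb{R}^d$ over $\mathbb{R}$, equivalently if it equals $A\mathbb{Z}^d$ for some nonsingular real $d\times d$ matrix $A$. The volume of $L = A\mathbb{Z}^d$ is $\mathrm{vol}(L) = |\det A|$, i.e. the volume of the fundamental parallelepiped $A[0,1)^d$ (independent of the choice of $A$). A fundamental domain of $L$ in $\mathbb{R}^d$ is a set $F\subseteq\mathbb{R}^d$ (no measurability required) containing exactly one element of each coset of $L$ in $\mathbb{R}^d$. A common fundamental domain of $L$ and $M$ is a set that is a fundamental domain of $L$ and also a fundamental domain of $M$. *)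

(* Defs.v *)
From mathcomp Require Import all_boot all_order all_algebra.
From mathcomp Require Import all_classical all_reals all_analysis.

Set Implicit Arguments.
Unset Strict Implicit.
Unset Printing Implicit Defensive.

Import Order.TTheory GRing.Theory Num.Theory.
Import numFieldNormedType.Exports.

Local Open Scope classical_set_scope.
Local Open Scope ring_scope.

Section Lattices.
Context {R : realType} {d : nat}.
Implicit Types (L M F : set 'cV[R]_d) (A B : 'M[R]_d).

Definition lattice L : Prop :=
  zmod_closed (mem L) /\ L `<=` isolated L.

(* [<<X>>] is the span of a finite sequence; [L] spans R^d when every vector
   lies in the span of finitely many elements of [L]. *)
Definition full_rank L : Prop :=
  forall v : 'cV[R]_d,
    exists2 X : seq 'cV[R]_d, {in X, forall x, L x} & v \in <<X>>%VS.

Definition mxlattice A : set 'cV[R]_d :=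
  range (fun z : 'cV[int]_d => A *m map_mx intr z).

(* The default value 0 is taken only when [L] has no basis, i.e. when [L] is not
   a full-rank lattice; [vol_mxlattice] shows that the chosen value does not
   depend on the basis. *)
Definition vol L : R :=
  xget 0 [set v : R | exists2 A : 'M[R]_d,
            A \in unitmx & L = mxlattice A /\ v = `|\det A|].

Definition fundamental_domain L F : Prop :=
  forall x : 'cV[R]_d, exists! y : 'cV[R]_d, F y /\ L (y - x).

Definition common_fundamental_domain L M F : Prop :=
  fundamental_domain L F /\ fundamental_domain M F.

Lemma mxlattice_subset_det A B : A \in unitmx ->
  mxlattice A `<=` mxlattice B -> `|\det B| <= `|\det A|.
Proof.
move=> Au sAB.
have /choice[f fE] (j : 'I_d) :
    exists z : 'cV[int]_d, B *m map_mx intr z = col j A.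
  have [|z _ zE] := sAB (col j A); last by exists z.
  exists (delta_mx j 0) => //; rewrite [RHS]colE; congr (_ *m _).
  by apply/matrixP => a b; rewrite !mxE; case: (_ && _).
pose U : 'M[int]_d := \matrix_(i, j) f j i 0.
have AE : A = B *m map_mx intr U.
  apply/matrixP => i j.
  have /matrixP/(_ i 0) := fE j.
  rewrite !mxE => <-; apply: eq_bigr => k _.
  by rewrite !mxE.
have : \det A != 0 by rewrite -unitfE -unitmxE.
rewrite AE det_mulmx normrM det_map_mx mulf_eq0 negb_or => /andP[_].
rewrite intr_eq0 => U0; apply: ler_peMr => //.
by rewrite -intr_norm -[1](_ : 1%:~R = 1)// ler_int -gtz0_ge1 normr_gt0.
Qed.

Lemma vol_mxlattice A : A \in unitmx -> vol (mxlattice A) = `|\det A|.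
Proof.
move=> Au; rewrite /vol; case: xgetP => [v _ [B Bu [AB ->]]|/(_ `|\det A|)].
  apply/eqP; rewrite eq_le !mxlattice_subset_det// -?AB//.
by case; exists A.
Qed.

End Lattices.

(* Main.v *)
Require Import Defs.
From mathcomp Require Import all_boot all_order all_algebra.
From mathcomp Require Import all_classical all_reals all_analysis.
From mathcomp Require Import perm lra.
Import Order.TTheory GRing.Theory Num.Theory.
Import numFieldNormedType.Exports.
Local Open Scope classical_set_scope.
Local Open Scope ring_scope.

(** If F is bounded, then sending l in L to the point m of M with l - m in F
    (F represents L modulo M) displaces points by a bounded amount, and it is
    injective because F contains at most one point of each coset of L. Such an
    injection forces vol M <= vol L. Expressed in bases, it is an injection of
    Z^d at bounded distance from a linear map T, and |det T| >= 1 has to be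
    shown. Integer rounding makes every shear an injection of Z^d up to bounded
    error, so row and column operations reduce T to a diagonal matrix, for
    which one counts integer points in boxes. The same estimate bounds the
    determinants of the sublattices of a discrete group from below, and hence
    gives the existence of a basis. *)

(** * Injections of Z^d at bounded distance from a linear map *)

Section BoundedDisplacement.
Context {R : realType}.

Definition bounded_family {d} {T : Type} (u : T -> 'cV[R]_d) : Prop :=
  exists C, forall t i, `|u t i 0| <= C.

Lemma bounded_familyD {d T} (u v : T -> 'cV[R]_d) :
  bounded_family u -> bounded_family v -> bounded_family (fun t => u t + v t).
Proof.
move=> [C uC] [D vD]; exists (C + D) => t i; rewrite mxE.
by apply: le_trans (ler_normD _ _) _; rewrite lerD.
Qed.

Lemma bounded_family_mul {m d T} (S : 'M[R]_(m, d)) (u : T -> 'cV[R]_d) :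
  bounded_family u -> bounded_family (fun t => S *m u t).
Proof.
(* Summing over every row makes the bound independent of [i]. The absolute value guards against a
   negative [C], possible when the family has no entries. *)
move=> [C uC]; exists (\sum_i \sum_j `|S i j| * `|C|) => t i.
rewrite mxE (bigD1 i)//= (le_trans (ler_norm_sum _ _ _))// ler_wpDr//.
  by apply: sumr_ge0 => k _; apply: sumr_ge0 => j _; rewrite mulr_ge0.
apply: ler_sum => j _; rewrite normrM ler_wpM2l//.
exact: le_trans (uC t j) (ler_norm C).
Qed.

Lemma bounded_family_floor {d T} (u : T -> 'cV[R]_d) :
  bounded_family (fun t => u t - map_mx intr (map_mx Num.floor (u t))).
Proof.
exists 1 => t i; rewrite !mxE.
have /andP[] := floor_itv (u t i 0); rewrite intrD => h1 h2.
by rewrite ler_norml; lra.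
Qed.

Lemma bounded_family_col {m n T} (u : T -> 'cV[R]_m) (v : T -> 'cV[R]_n) :
  bounded_family u -> bounded_family v ->
  bounded_family (fun t => col_mx (u t) (v t)).
Proof.
move=> [C uC] [D vD]; exists (Num.max C D) => t i.
by rewrite mxE; case: fintype.split => j; rewrite le_max ?uC ?vD ?orbT.
Qed.

Lemma bounded_family0 {d T} : bounded_family (fun _ : T => 0 : 'cV[R]_d).
Proof. by exists 0 => t i; rewrite mxE normr0. Qed.

Definition lattice_embedding {d} (S : 'M[R]_d) : Prop :=
  exists2 f : 'cV[int]_d -> 'cV[int]_d, injective f &
    bounded_family (fun z => S *m map_mx intr z - map_mx intr (f z)).

Lemma lattice_embeddingM {d} (S T : 'M[R]_d) :
  lattice_embedding S -> lattice_embedding T -> lattice_embedding (S *m T).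
Proof.
move=> [f finj fS] [g ginj gT]; exists (f \o g); first exact: inj_comp.
have [C fgC] : bounded_family (fun z => S *m (T *m map_mx intr z
    - map_mx intr (g z)) + (S *m map_mx intr (g z) - map_mx intr (f (g z)))).
  apply: bounded_familyD; first exact: bounded_family_mul.
  by have [C fC] := fS; exists C.
by exists C => z i; have := fgC z i; rewrite mulmxBr mulmxA addrA subrK.
Qed.

Lemma lattice_embedding_perm {d} (s : 'S_d) :
  lattice_embedding (perm_mx s).
Proof.
exists (mulmx (perm_mx s)); first exact: can_inj (mulKmx (unitmx_perm _ s)).
by exists 0 => z i; rewrite map_mxM map_perm_mx subrr mxE normr0.
Qed.

(* Rounding a unipotent block map still gives an injection of Z^d, because the
   rounded block only depends on coordinates that can be recovered first. *)
Lemma lattice_embedding_lblock {m n} (A : 'M[R]_(n, m)) (S : 'M[R]_n) :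
  lattice_embedding S -> lattice_embedding (block_mx (1%:M : 'M[R]_m) 0 A S).
Proof.
move=> [f finj fS].
pose fl (x : 'cV[int]_m) : 'cV[int]_n := map_mx Num.floor (A *m map_mx intr x).
exists (fun z => col_mx (usubmx z) (fl (usubmx z) + f (dsubmx z))).
  move=> x y /eq_col_mx[xy]; rewrite xy => /addrI/finj xy'.
  by rewrite -[x]vsubmxK xy xy' vsubmxK.
have [C fC] : bounded_family (fun z : 'cV[int]_(m + n) =>
    col_mx (0 : 'cV[R]_m)
     (A *m map_mx intr (usubmx z) - map_mx intr (fl (usubmx z)) +
     (S *m map_mx intr (dsubmx z) - map_mx intr (f (dsubmx z))))).
  apply: bounded_family_col; first exact: bounded_family0.
  apply: bounded_familyD; first exact: bounded_family_floor.
  by have [C fC] := fS; exists C.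
exists C => z i; have := fC z i.
rewrite -[in block_mx _ _ _ _ *m _](vsubmxK z) !map_col_mx mul_block_col.
rewrite mul1mx mul0mx addr0.
by rewrite opp_col_mx add_col_mx subrr map_mxD opprD addrACA.
Qed.

Lemma lattice_embedding_ublock {m n} (A : 'M[R]_(m, n)) (S : 'M[R]_n) :
  lattice_embedding S -> lattice_embedding (block_mx (1%:M : 'M[R]_m) A 0 S).
Proof.
move=> [f finj fS].
pose fl (x : 'cV[int]_n) : 'cV[int]_m := map_mx Num.floor (A *m map_mx intr x).
exists (fun z => col_mx (usubmx z + fl (dsubmx z)) (f (dsubmx z))).
  move=> x y /eq_col_mx[+ /finj xy]; rewrite xy => /addIr xy'.
  by rewrite -[x]vsubmxK xy xy' vsubmxK.
have [C fC] : bounded_family (fun z : 'cV[int]_(m + n) =>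
    col_mx (A *m map_mx intr (dsubmx z) - map_mx intr (fl (dsubmx z)))
     (S *m map_mx intr (dsubmx z) - map_mx intr (f (dsubmx z)))).
  apply: bounded_family_col; first exact: bounded_family_floor.
  by have [C fC] := fS; exists C.
exists C => z i; have := fC z i.
rewrite -[in block_mx _ _ _ _ *m _](vsubmxK z) !map_col_mx mul_block_col.
rewrite mul1mx mul0mx add0r.
by rewrite opp_col_mx add_col_mx map_mxD opprD addrACA subrr add0r.
Qed.

Lemma lattice_embedding1 {d} : lattice_embedding (1%:M : 'M[R]_d).
Proof. by rewrite -perm_mx1; exact: lattice_embedding_perm. Qed.

(** Gaussian elimination with full pivoting: [X] and [Y] are products of permutations and unipotent
    block matrices. These are lattice embeddings, so the diagonal matrix is one as soon as [T]
    is. *)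
Lemma diagonal_reduction {d} (T : 'M[R]_d) :
  exists X Y (v : 'rV[R]_d), [/\ lattice_embedding X, lattice_embedding Y,
    `|\det X| = 1, `|\det Y| = 1 & X *m T *m Y = diag_mx v].
Proof.
have det_tperm n (i j : 'I_n) : `|\det (tperm_mx i j : 'M[R]_n)| = 1.
  by rewrite det_perm normrX normrN1 expr1n.
elim: d T => [T|d IH].
  exists 1%:M, 1%:M, 0; split; rewrite ?det1 ?normr1//;
    try exact: lattice_embedding1.
  by apply/matrixP => -[].
rewrite -[d.+1]/(1 + d)%N => T.
have [->|/eqP/matrixP/existsNP[i /existsNP[j]]] := eqVneq T 0.
  exists 1%:M, 1%:M, 0; split; rewrite ?det1 ?normr1//;
    try exact: lattice_embedding1.
  by rewrite mul1mx mul0mx; apply/matrixP => i j; rewrite !mxE mul0rn.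
rewrite mxE => /eqP Tij0.
(* Two transpositions bring a nonzero entry to the top left corner as the pivot [a]. *)
pose P := @tperm_mx R (1 + d) ord0 i; pose Q := @tperm_mx R (1 + d) ord0 j.
pose T1 : 'M[R]_(1 + d) := P *m T *m Q.
pose a := T1 ord0 ord0.
have a0 : a != 0 by rewrite /a /T1 -xcolE -xrowE !mxE !tpermL.
have ulE : ulsubmx T1 = a%:M.
  by rewrite [LHS]mx11_scalar 2!mxE /a; congr (T1 _ _)%:M; exact: val_inj.
pose A := dlsubmx T1; pose B := ursubmx T1; pose W := drsubmx T1.
have T1E : T1 = block_mx a%:M B A W by rewrite -ulE submxK.
(* Clearing the first row and column with the pivot leaves its Schur complement, to which the
   induction hypothesis applies. *)
have [X [Y [v [eX eY dX dY E]]]] := IH (W - a^-1 *: (A *m B)).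
exists ((block_mx 1%:M 0 0 X : 'M[R]_(1 + d)) *m
  block_mx 1%:M 0 (- a^-1 *: A) 1%:M *m P).
exists (Q *m (block_mx 1%:M (- a^-1 *: B) 0 1%:M *m
  (block_mx 1%:M 0 0 Y : 'M[R]_(1 + d)))).
exists (row_mx a%:M v); split.
- apply: lattice_embeddingM; last exact: lattice_embedding_perm.
  apply: lattice_embeddingM; apply: lattice_embedding_lblock => //.
  exact: lattice_embedding1.
- apply: lattice_embeddingM; first exact: lattice_embedding_perm.
  apply: lattice_embeddingM; apply: lattice_embedding_ublock => //.
  exact: lattice_embedding1.
- by rewrite !det_mulmx !det_lblock !normrM dX det_tperm !det1 !normr1 !mul1r.
- by rewrite !det_mulmx !det_ublock !normrM dY det_tperm !det1 !normr1 !mul1r.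
rewrite !mulmxA -[_ *m P *m T]mulmxA -[_ *m (P *m T) *m Q]mulmxA -/T1 T1E.
rewrite -!mulmxA !(mulmxA (block_mx a%:M _ _ _)) !mulmx_block.
rewrite !(mulmx1, mul1mx, mul0mx, mulmx0, addr0, add0r).
rewrite !mul_scalar_mx !mul_mx_scalar.
rewrite !scalerA mulrN divff// !scaleN1r !addNr !(mulmx0, mul0mx) add0r.
rewrite -scalemxAr scaleNr [- _ + W]addrC mulmxA E diag_mx_row; congr block_mx.
by apply/matrixP => k l; rewrite !mxE !ord1.
Qed.

(** The product is a polynomial in the added constant, hence continuous, and [C / n.+1] tends to
    0. *)
Lemma prod_addr_ge1 {d} (v : 'I_d -> R) (C : R) :
  (forall n : nat, 1 <= \prod_i (v i + C / n.+1%:R)) -> 1 <= \prod_i v i.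
Proof.
move=> H; pose p : {poly R} := \prod_i ((v i)%:P + 'X).
have pE x : p.[x] = \prod_i (v i + x).
  by rewrite horner_prod; apply: eq_bigr => i _; rewrite !hornerE.
have -> : \prod_i v i = p.[C * 0].
  by rewrite pE mulr0; apply: eq_bigr => i _; rewrite addr0.
have cp : p.[C * harmonic n] @[n --> \oo] --> p.[C * 0].
  apply: (@continuous_cvg _ _ _ _ _ _ (horner p)).
    exact: continuous_horner.
  by apply: cvgM; [exact: cvg_cst | exact: cvg_harmonic].
rewrite -(cvg_lim _ cp)//; apply: limr_ge.
  by apply/cvg_ex; exists p.[C * 0].
by apply: nearW => n; rewrite pE; exact: H.
Qed.

(* Compares the number of points of [0, n)^d with the number of integer points
   of the box containing their images. *)
Lemma lattice_embedding_diag {d} (v : 'rV[R]_d) :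
  lattice_embedding (diag_mx v) -> 1 <= \prod_i `|v 0 i|.
Proof.
(* Each side of the box grows by [C] at both ends, and an interval of length [b] is allotted
   [trunc b + 1] integers; this gives [2 * C + 1]. *)
move=> [f finj [C fC]]; apply: (@prod_addr_ge1 _ _ (2 * C + 1)) => n.
(* [a i] bounds the [i]-th image coordinates from below whatever the sign of [v 0 i], and [b i] is
   the length of the interval containing them. *)
pose a i := Num.min 0 (v 0 i * n.+1%:R) - C.
pose b i := `|v 0 i| * n.+1%:R + 2 * C.
pose zn (z : {ffun 'I_d -> 'I_n.+1}) : 'cV[int]_d := \col_i (z i)%:Z.
pose g z i := f (zn z) i 0 - Num.ceil (a i).
have b0 i : 0 <= b i.
  by rewrite addr_ge0 ?mulr_ge0//; apply: le_trans (fC 0 i); exact: normr_ge0.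
have gP z i : 0 <= g z i <= (Num.trunc (b i))%:Z.
  rewrite /g.
  have := fC (zn z) i.
  rewrite mul_diag_mx !mxE -pmulrn ler_norml => /andP[h1 h2].
  have z0 : 0 <= (z i)%:R :> R by rewrite ler0n.
  have zle : (z i)%:R <= n.+1%:R :> R by rewrite ler_nat ltnW.
  have h : Num.min 0 (v 0 i * n.+1%:R) <= v 0 i * (z i)%:R
     <= Num.min 0 (v 0 i * n.+1%:R) + `|v 0 i| * n.+1%:R.
    have [v0|v0] := lerP 0 (v 0 i).
      by rewrite min_l ?mulr_ge0// add0r ger0_norm//= ler_wpM2l.
    by rewrite min_r ?ltr0_norm//; nra.
  rewrite subr_ge0 ceil_le_int; apply/andP; split.
    by rewrite /a; lra.
  have ba : (f (zn z) i 0 - Num.ceil (a i))%:~R <= b i.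
    have := ceil_ge (a i); rewrite intrB /b /a; lra.
  rewrite -(ler_int R); apply: le_trans (_ : (Num.floor (b i))%:~R <= _).
    by rewrite ler_int floor_ge_int.
  rewrite truncn_floor b0 gez0_abs ?floor_ge0//.
have ginj : injective (fun z => [ffun i => inord `|g z i|%N]
    : {dffun forall i, 'I_(Num.trunc (b i)).+1}).
  move=> x y /ffunP xy; suff /finj/matrixP zxy : f (zn x) = f (zn y).
    by apply/ffunP => i; apply/val_inj; have := zxy i 0; rewrite !mxE => -[].
  apply/colP => i; have /(congr1 val) := xy i; rewrite !ffunE /=.
  have [/andP[gx0 gx] /andP[gy0 gy]] := (gP x i, gP y i).
  rewrite !inordK ?ltnS -?lez_nat ?gez0_abs// => /(congr1 Posz).
  by rewrite !gez0_abs// => /addIr.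
(* Counting gives (n+1)^d <= prod_i (trunc (b i) + 1); dividing each factor by n+1 yields the
   required bound. *)
have := leq_card _ ginj.
rewrite card_ffun card_dep_ffun !card_ord foldrE big_map big_enum/=.
under eq_bigr do rewrite card_ord.
rewrite -(ler_nat R) natrX natr_prod => H.
under eq_bigr => i _.
  rewrite (_ : _ + _ = (`|v 0 i| * n.+1%:R + (2 * C + 1)) / n.+1%:R);
    last by rewrite [RHS]mulrDl mulfK.
  over.
rewrite big_split/= prodr_const card_ord exprVn ler_pdivlMr ?exprn_gt0// mul1r.
apply: le_trans H _; apply: ler_prod => i _.
rewrite ler0n/= -natr1 addrA lerD2r.
by rewrite truncn_le.
Qed.


Lemma lattice_embedding_det {d} (T : 'M[R]_d) :
  lattice_embedding T -> 1 <= `|\det T|.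
Proof.
have [X [Y [v [eX eY dX dY E]]]] := diagonal_reduction T => eT.
have : lattice_embedding (diag_mx v).
  by rewrite -E; do 2 ?apply: lattice_embeddingM.
move=> /lattice_embedding_diag; rewrite -normr_prod -det_diag -E !det_mulmx.
by rewrite !normrM dX dY mul1r mulr1.
Qed.

End BoundedDisplacement.

(** * Determinants of sublattices and existence of lattice bases *)

Section LatticeBasis.
Context {R : realType} {d : nat}.
Implicit Types (A B : 'M[R]_d) (L : set 'cV[R]_d).

(** Applying [invmx B] keeps the error bounded, so [f] makes [invmx B *m A] a lattice embedding. *)
Lemma le_det_bounded_displacement A B (f : 'cV[int]_d -> 'cV[int]_d) :
  B \in unitmx -> injective f ->
  bounded_family (fun z => A *m map_mx intr z - B *m map_mx intr (f z)) ->
  `|\det B| <= `|\det A|.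
Proof.
move=> Bu finj /(bounded_family_mul (invmx B))[C fC].
have /lattice_embedding_det : lattice_embedding (invmx B *m A).
  exists f => //; exists C => z i.
  by have := fC z i; rewrite mulmxBr mulKmx// mulmxA.
have B0 : 0 < `|\det B| by rewrite normr_gt0 -unitfE -unitmxE.
by rewrite det_mulmx det_inv normrM normfV mulrC ler_pdivlMr// mul1r.
Qed.

Lemma zmod_closed_mulmx L A (z : 'cV[int]_d) : zmod_closed (mem L) ->
  (forall j, L (col j A)) -> L (A *m map_mx intr z).
Proof.
move=> [L0 LB] LA.
have LN x : L x -> L (- x).
  by move=> /mem_set Lx; rewrite -sub0r; apply/set_mem/LB.
have LD x y : L x -> L y -> L (x + y).
  move=> /mem_set Lx Ly; rewrite -[y]opprK; apply/set_mem/LB => //.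
  exact/mem_set/LN.
have Ln x (n : nat) : L x -> L (x *+ n).
  move=> Lx; elim: n => [|n IH]; first exact/set_mem.
  by rewrite mulrS; exact: LD.
have -> : A *m map_mx intr z = \sum_j col j A *~ z j 0.
  apply/colP => i; rewrite mxE summxE; apply: eq_bigr => j _.
  by rewrite -scaler_int !mxE mulrC.
elim/big_ind: _ => //; first exact/set_mem.
by move=> j _; case: (z j 0) => n; [exact: Ln | exact/LN/Ln].
Qed.

Lemma lattice_separated L : lattice L ->
  exists2 r : R, 0 < r & forall x, L x -> (forall i, `|x i 0| < r) -> x = 0.
Proof.
move=> [[/set_mem L0 _] /(_ _ L0)[_ [V /nbhs_ballP[r /= r0 rV] VL]]].
exists r => // x Lx xr; suff : [set 0] x by [].
rewrite -VL; split => //; apply: rV; split => // i j.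
by rewrite mxE /ball/= sub0r normrN ord1.
Qed.

(** Round the points of [mxlattice A] to the grid r Z^d. Two points with the same rounding differ by
    less than [r] in every coordinate, hence coincide, so [A] can be compared with [r%:M]. *)
Lemma det_mxlattice_ge L A (r : R) : zmod_closed (mem L) -> A \in unitmx ->
  (forall j, L (col j A)) -> 0 < r ->
  (forall x, L x -> (forall i, `|x i 0| < r) -> x = 0) -> r ^+ d <= `|\det A|.
Proof.
move=> Lz Au LA r0 Lr; pose u z : 'cV[R]_d := r^-1 *: (A *m map_mx intr z).
have <- : `|\det (r%:M : 'M[R]_d)| = r ^+ d.
  by rewrite det_scalar normrX gtr0_norm.
apply: (@le_det_bounded_displacement _ _ (fun z => map_mx Num.floor (u z))).
- by rewrite unitmxE det_scalar unitfE expf_neq0 ?gt_eqF.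
- move=> x y xy; have : A *m map_mx intr (x - y) = 0.
    apply: Lr => [|i]; first exact: zmod_closed_mulmx.
    have h : Num.floor (r^-1 * (A *m map_mx intr x) i 0) =
        Num.floor (r^-1 * (A *m map_mx intr y) i 0).
      by have /colP/(_ i) := xy; rewrite !mxE.
    have /andP[] := floor_itv (r^-1 * (A *m map_mx intr x) i 0).
    have /andP[] := floor_itv (r^-1 * (A *m map_mx intr y) i 0).
    rewrite h !intrD => h1 h2 h3 h4.
    rewrite map_mxB mulmxBr mxE [X in _ + X]mxE.
    rewrite -[ltRHS]mulr1 -ltr_pdivrMl// -[r^-1]gtr0_norm ?invr_gt0// -normrM.
    by rewrite mulrBr ltr_norml; lra.
  move=> /(congr1 (mulmx (invmx A))); rewrite mulKmx// mulmx0 => /matrixP xy0.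
  apply/colP => i; have /eqP := xy0 i 0; rewrite !mxE intr_eq0 subr_eq0.
  by move/eqP.
have [C uC] := bounded_family_mul (r%:M) _ (bounded_family_floor u).
exists C => z i; have := uC z i.
by rewrite mulmxBr mul_scalar_mx scalerA divff ?gt_eqF// scale1r.
Qed.

(** Pool finite families of [L] spanning the standard basis vectors, then extract [d] independent
    vectors from the pool. *)
Lemma full_rank_unitmx L : full_rank L ->
  exists2 A, A \in unitmx & forall j, L (col j A).
Proof.
move=> Lf; have /choice[X XP] (j : 'I_d) : exists X : seq 'cV[R]_d,
    {in X, forall x, L x} /\ delta_mx j 0 \in <<X>>%VS.
  by have [X] := Lf (delta_mx j 0); exists X.
pose Y := flatten [seq X j | j <- enum 'I_d].
have LY i : (i < size Y)%N -> L Y`_i.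
  move=> /(mem_nth 0)/flattenP[s /mapP[j _ ->]]; exact: (XP j).1.
have YE j : delta_mx j 0 \in <<Y>>%VS.
  apply: subvP (XP j).2; apply: sub_span => x xX.
  by apply/flattenP; exists (X j) => //; rewrite map_f// mem_enum.
pose M : 'M[R]_(size Y, d) := \matrix_(i, k) Y`_i k 0.
have Mfull : row_full M.
  apply/row_fullP; exists (\matrix_(j, i) coord (in_tuple Y) i (delta_mx j 0)).
  apply/matrixP => j k.
  have /colP/(_ k) := @coord_span _ _ _ (in_tuple Y) _ (YE j).
  rewrite !mxE andbT eq_sym => ->; rewrite summxE; apply: eq_bigr => i _.
  by rewrite !mxE.
exists (rowsub (fullrankfun Mfull) M)^T.
  by rewrite unitmx_tr fullrowsub_unit.
move=> j; rewrite (_ : col _ _ = Y`_(fullrankfun Mfull j)); first exact: LY.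
by apply/colP => k; rewrite !mxE.
Qed.

(** A vector of [L] outside [mxlattice A], reduced modulo [mxlattice A], has coordinates of size at
    most 1/2 in the basis [A], not all zero. It replaces a column at which its coordinate is
    nonzero. *)
Lemma lattice_halve L A : zmod_closed (mem L) -> A \in unitmx ->
  (forall j, L (col j A)) -> ~ (L `<=` mxlattice A) ->
  exists B,
    [/\ B \in unitmx, forall j, L (col j B) & `|\det B| <= `|\det A| / 2].
Proof.
move=> Lz Au LA /existsNP[v /not_implyP[Lv vA]].
(* Adding 1/2 before taking the floor rounds to a nearest integer. *)
pose c := invmx A *m v; pose z := map_mx Num.floor (c + const_mx (1/2)).
pose e := c - map_mx intr z.
have Le : L (A *m e).
  rewrite mulmxBr mulKVmx//; apply/set_mem/Lz.2; apply/mem_set => //.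
  exact: zmod_closed_mulmx.
have e2 i : `|e i 0| <= 1 / 2.
  have /andP[] := floor_itv (c i 0 + 1 / 2); rewrite intrD => h1 h2.
  have -> : e i 0 = c i 0 - (Num.floor (c i 0 + 1 / 2))%:~R by rewrite !mxE.
  by rewrite ler_norml; lra.
have [i ei0] : exists i, e i 0 != 0.
  apply: contrapT => /forallNP e0; apply: vA; exists z => //.
  suff /eqP : e = 0 by rewrite subr_eq0 => /eqP <-; rewrite mulKVmx.
  by apply/colP => i; rewrite [RHS]mxE; apply: contrapT => /eqP /e0.
(* [E] is the identity with column [i] replaced by [e], so [A *m E] is [A] with column [i] replaced
   by [A *m e]. *)
pose E : 'M[R]_d := \matrix_(a, b) if b == i then e a 0 else (a == b)%:R.
have detE : \det E = e i 0.
  rewrite (expand_det_row _ i) (bigD1 i)//= big1 ?addr0.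
    rewrite mxE eqxx /cofactor (_ : row' i (col' i E) = 1%:M).
      by rewrite det1 mulr1 -signr_odd addnn odd_double mulr1.
    apply/matrixP => a b; rewrite !mxE (inj_eq lift_inj).
    by rewrite eq_sym (negbTE (neq_lift _ _)).
  by move=> b bi; rewrite mxE (negbTE bi) eq_sym (negbTE bi) mul0r.
exists (A *m E); split.
- by rewrite unitmx_mul Au unitmxE detE unitfE.
- move=> b; rewrite colE -mulmxA -colE; have [->|bi] := eqVneq b i.
    by rewrite (_ : col i E = e)//; apply/colP => a; rewrite !mxE eqxx.
  rewrite (_ : col b E = delta_mx b 0) -?colE//.
  by apply/colP => a; rewrite !mxE (negbTE bi) andbT.
by rewrite det_mulmx normrM detE -[2^-1]mul1r ler_wpM2l.
Qed.

Lemma lattice_basis L : lattice L -> full_rank L ->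
  exists2 A, A \in unitmx & L = mxlattice A.
Proof.
move=> Ll Lf; have [Lz _] := Ll.
have [r r0 Lr] := lattice_separated _ Ll.
pose D := [set `|\det A| |
  A in [set A | A \in unitmx /\ forall j, L (col j A)]].
have Dr x : D x -> r ^+ d <= x.
  by move=> [A [Au LA] <-]; apply: det_mxlattice_ge LA _ Lr.
have D0 : has_inf D.
  split; last by exists (r ^+ d).
  by have [A Au LA] := full_rank_unitmx _ Lf; exists `|\det A|, A.
have iD : 0 < inf D.
  by apply: lt_le_trans (lb_le_inf D0.1 Dr); rewrite exprn_gt0.
(* Taking the positive number [inf D] itself as the tolerance gives a determinant below [2 * inf D];
   halving it would go below the infimum. *)
have [_ [A [Au LA] <-] Alt] := inf_adherent iD D0.
exists A => //; apply/seteqP; split; last first.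
  by move=> _ [z _ <-]; exact: zmod_closed_mulmx.
apply: contrapT => /(lattice_halve _ _ Lz Au LA)[B [Bu LB BA]].
have : inf D <= `|\det B| by apply: ge_inf; [exact: D0.2 | exists B].
by lra.
Qed.

End LatticeBasis.

(** * Unboundedness of a common fundamental domain *)

Theorem theorem1p1 (R : realType) (d : nat) (L M F : set 'cV[R]_d)
    (L_lattice : lattice L) (L_full : full_rank L)
    (M_lattice : lattice M) (M_full : full_rank M)
    (vol_lt : vol L < vol M)
    (LM0 : L `&` M = [set 0])
    (F_common : common_fundamental_domain L M F) :
  ~ bounded_set F.
Proof.
move=> [C [_ /(_ (C + 1))]]; rewrite ltrDl ltr01 => /(_ isT)/= FC.
have [[A Au LA] [B Bu MB]] := (lattice_basis _ L_lattice L_full,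
                               lattice_basis _ M_lattice M_full).
have [domL domM] := F_common.
(* The point of [F] representing the [L]-vector [A z] modulo [M] is [A z - B (f z)]. *)
have /choice[f fP] (z : 'cV[int]_d) : exists w : 'cV[int]_d,
    F (A *m map_mx intr z - B *m map_mx intr w).
  have [y [[Fy]]] := domM (A *m map_mx intr z).
  rewrite MB => -[w _ wE] _; exists (- w).
  by rewrite map_mxN mulmxN opprK wE addrC subrK.
move: vol_lt; rewrite LA MB !vol_mxlattice// ltNge => /negP; apply.
apply: (@le_det_bounded_displacement _ _ _ _ f) => //; last first.
  exists (C + 1) => z i; apply: le_trans (FC _ (fP z)).
  rewrite [leRHS]mx_normrE.
  exact: (le_bigmax _ (fun p =>
    `|(A *m map_mx intr z - B *m map_mx intr (f z)) p.1 p.2|) (i, 0)).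
(* If [f x = f y], both representatives lie in [F] and in the coset of [- B (f x)] modulo [L]; they
   equal its unique representative [u]. *)
move=> x y xy; have [u [_ uP]] := domL (- (B *m map_mx intr (f x))).
have uE z : f z = f x -> A *m map_mx intr z - B *m map_mx intr (f z) = u.
  move=> zx; apply/esym/uP; split; first exact: fP.
  by rewrite zx opprK subrK LA; exists z.
have /addIr/(congr1 (mulmx (invmx A))) :
    A *m map_mx intr x - B *m map_mx intr (f x) =
    A *m map_mx intr y - B *m map_mx intr (f x).
  by rewrite {2}xy !uE.
rewrite !mulKmx// => /matrixP E; apply/colP => i; have := E i 0.
by rewrite !mxE => /intr_inj.
Qed.
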